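(* Let $K$ be an augmented cochain complex with augmentation $\epsilon:K\to\Bbbk$, let $\Omega$ be a differential graded algebra, and let $\psi:K^*\to(K\otimes\Omega)^{*+1}$ be an $\Omega$-valued twisting map on $K$. Assume that for every $\alpha\in K$ there exists a natural number $n=n(\alpha)$ such that $\psi_{(k)}(\alpha)=0$ for all $k\ge n$. Then the map $$\tilde\psi:K\to B(\Omega),\qquad \tilde\psi(\alpha)=\sum_{k=1}^\infty\psi_{(k)}(\alpha)$$ is well defined and is a homomorphism of cochain complexes (i.e. commutes with the differentials).
   Context: $\Bbbk$ is a field of characteristic $0$; all differentials have degree $+1$. An augmentation is a morphism of complexes $\epsilon:K\to\Bbbk$ (with $\Bbbk$ in degree $0$ with zero differential), so $\epsilon$ vanishes outside degree $0$ and $\epsilon d=0$. A linear map $\psi:K\to K\otimes\Omega$ of degree $+1$ is called an $\Omega$-valued twisting map if the operator on $K\otimes\Omega$ $$d_\psi(\alpha\otimes\beta)=d\alpha\otimes\beta+(-1)^{|\alpha|}\alpha\otimes d\beta+(1\otimes m)(\psi\otimes 1)(\alpha\otimes\beta)$$ ($m$ the multiplication of $\Omega$, $(\psi\otimes 1)(\alpha\otimes\beta)=\psi(\alpha)\otimes\beta$) satisfies $d_\psi^2=0$. The maps $\psi_{(k)}:K\to\Omega^{\otimes k}$ are $$\psi_{(k)}(\alpha)=(\epsilon\otimes1^{\otimes k})(\psi\otimes1^{\otimes(k-1)})\cdots(\psi\otimes1)\psi(\alpha),\qquad k\ge1 .$$ $B(\Omega)=\bigoplus_{n\ge1}\Omega^{\otimes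 n}$ is the bar complex of $\Omega$, where $a_1\otimes\dots\otimes a_n$ has degree $\sum|a_i|-n$. Its differential, in the sign normalization used here, is $$D(a_1\otimes\dots\otimes a_n)=(-1)^n\Bigl(\sum_{i=1}^n(-1)^{|a_1|+\dots+|a_{i-1}|}a_1\otimes\dots\otimes da_i\otimes\dots\otimes a_n-\sum_{i=1}^{n-1}(-1)^{i-1}a_1\otimes\dots\otimes a_ia_{i+1}\otimes\dots\otimes a_n\Bigr);$$ up to rescaling tensors by signs this is the usual bar differential. *)

(* Defs.v *)
From HB Require Import structures.
From mathcomp Require Import all_boot all_order all_algebra.
From mathcomp Require Import boolp.

Set Implicit Arguments.
Unset Strict Implicit.
Unset Printing Implicit Defensive.

Import Order.TTheory GRing.Theory Num.Theory.
Local Open Scope ring_scope.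
Local Open Scope quotient_scope.

Definition bilin (k : fieldType) (U V W : lmodType k) (f : U -> V -> W) : Prop :=
  (forall v c u u', f (c *: u + u') v = c *: f u v + f u' v) /\
  (forall u c v v', f u (c *: v + v') = c *: f u v + f u v').

Definition mk_linear (k : fieldType) (U V : lmodType k) (f : U -> V)
    (fL : linear f) : {linear U -> V} :=
  HB.pack f (GRing.isLinear.Build k U V *:%R f fL).

Definition mk_bilinear (k : fieldType) (U V W : lmodType k) (f : U -> V -> W)
    (fB : bilin f) : {bilinear U -> V -> W} :=
  HB.pack f (bilinear_isBilinear.Build k U V W *:%R *:%R f (proj1 fB, proj2 fB)).

Lemma mk_linearE (k : fieldType) (U V : lmodType k) (f : U -> V) fL x :
  @mk_linear k U V f fL x = f x.
Proof. by []. Qed.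

Lemma mk_bilinearE (k : fieldType) (U V W : lmodType k) (f : U -> V -> W) fB x y :
  @mk_bilinear k U V W f fB x y = f x y.
Proof. by []. Qed.

Global Opaque mk_linear mk_bilinear.

Section TensorProduct.
Variables (k : fieldType) (V W : lmodType k).

(* A list of pairs stands for the corresponding sum of pure tensors; two sums
   are identified when no bilinear map separates them; [tens_liftE] and
   [eq_tens_lin] give the universal property. *)
Definition tens_rel (s t : seq (V * W)) : bool :=
  `[< forall (U : lmodType k) (f : {bilinear V -> W -> U}),
        \sum_(p <- s) f p.1 p.2 = \sum_(p <- t) f p.1 p.2 >].

Lemma tens_rel_refl : reflexive tens_rel.
Proof. by move=> s; apply/asboolP. Qed.

Lemma tens_rel_sym : symmetric tens_rel.
Proof.
by move=> s t; apply/idP/idP => /asboolP st; apply/asboolP => U f; rewrite st.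
Qed.

Lemma tens_rel_trans : transitive tens_rel.
Proof.
move=> t s u /asboolP st /asboolP tu.
by apply/asboolP => U f; rewrite st tu.
Qed.

Canonical tens_equiv :=
  EquivRel tens_rel tens_rel_refl tens_rel_sym tens_rel_trans.

Definition tens_type : Type := {eq_quot tens_rel}.

HB.instance Definition _ := Choice.on tens_type.

Definition tens_of (s : seq (V * W)) : tens_type := \pi_({eq_quot tens_rel}) s.
Definition tens_repr (x : tens_type) : seq (V * W) :=
  repr (x : {eq_quot tens_rel}).

(* The lock keeps simplification from exposing representatives. *)
Definition tens_sum (U : lmodType k) (f : {bilinear V -> W -> U}) (x : tens_type) : U :=
  locked (\sum_(p <- tens_repr x) f p.1 p.2).

Lemma tens_sum_of (U : lmodType k) (f : {bilinear V -> W -> U}) s :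
  tens_sum f (tens_of s) = \sum_(p <- s) f p.1 p.2.
Proof.
rewrite /tens_sum -lock; have /asboolP -> // : tens_rel (tens_repr (tens_of s)) s.
by rewrite -[tens_rel _ _]/(tens_equiv _ _) -eqmodE /tens_repr /tens_of reprK.
Qed.

Lemma tens_ext (x y : tens_type) :
  (forall (U : lmodType k) (f : {bilinear V -> W -> U}), tens_sum f x = tens_sum f y) -> x = y.
Proof.
move=> xy; rewrite -[x]reprK -[y]reprK; apply/eqmodP.
by apply/asboolP => U f; have := xy U f; rewrite /tens_sum -!lock.
Qed.

Definition tens_add (x y : tens_type) := tens_of (tens_repr x ++ tens_repr y).
Definition tens_scale (c : k) (x : tens_type) :=
  tens_of [seq (c *: p.1, p.2) | p <- tens_repr x].

Lemma tens_sum_add (U : lmodType k) (f : {bilinear V -> W -> U}) x y :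
  tens_sum f (tens_add x y) = tens_sum f x + tens_sum f y.
Proof. by rewrite tens_sum_of big_cat /tens_sum -!lock. Qed.

Lemma tens_sum_scale (U : lmodType k) (f : {bilinear V -> W -> U}) c x :
  tens_sum f (tens_scale c x) = c *: tens_sum f x.
Proof.
rewrite tens_sum_of big_map /tens_sum -lock scaler_sumr; apply: eq_bigr => p _ /=.
by rewrite linearZl_LR.
Qed.

Lemma tens_sum0 (U : lmodType k) (f : {bilinear V -> W -> U}) : tens_sum f (tens_of [::]) = 0.
Proof. by rewrite tens_sum_of big_nil. Qed.

Lemma tens_addA : associative tens_add.
Proof. by move=> x y z; apply: tens_ext => U f; rewrite !tens_sum_add addrA. Qed.
Lemma tens_addC : commutative tens_add.
Proof. by move=> x y; apply: tens_ext => U f; rewrite !tens_sum_add addrC. Qed.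
Lemma tens_add0 : left_id (tens_of [::]) tens_add.
Proof. by move=> x; apply: tens_ext => U f; rewrite tens_sum_add tens_sum0 add0r. Qed.
Lemma tens_addN : left_inverse (tens_of [::]) (tens_scale (-1)) tens_add.
Proof.
move=> x; apply: tens_ext => U f.
by rewrite tens_sum_add tens_sum_scale tens_sum0 scaleN1r addNr.
Qed.

HB.instance Definition _ :=
  GRing.isZmodule.Build tens_type tens_addA tens_addC tens_add0 tens_addN.

Lemma tens_scaleA a b x : tens_scale a (tens_scale b x) = tens_scale (a * b) x.
Proof. by apply: tens_ext => U f; rewrite !tens_sum_scale scalerA. Qed.
Lemma tens_scale1 : left_id 1 tens_scale.
Proof. by move=> x; apply: tens_ext => U f; rewrite !tens_sum_scale scale1r. Qed.
Lemma tens_scaleDr : right_distributive tens_scale +%R.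
Proof.
move=> a x y; apply: tens_ext => U f.
by rewrite !(tens_sum_add, tens_sum_scale) scalerDr.
Qed.
Lemma tens_scaleDl x : {morph tens_scale^~ x : a b / a + b}.
Proof.
move=> a b; apply: tens_ext => U f.
by rewrite !(tens_sum_add, tens_sum_scale) scalerDl.
Qed.

HB.instance Definition _ := GRing.Zmodule_isLmodule.Build k tens_type
  tens_scaleA tens_scale1 tens_scaleDr tens_scaleDl.

Lemma tens_sum_linear (U : lmodType k) (f : {bilinear V -> W -> U}) : linear (tens_sum f).
Proof. by move=> c x y; rewrite tens_sum_add tens_sum_scale. Qed.

Definition tens : lmodType k := tens_type.

Definition tens_lift (U : lmodType k) (f : {bilinear V -> W -> U}) : {linear tens -> U} :=
  mk_linear (tens_sum_linear f).

Definition tpure_fun (v : V) (w : W) : tens := tens_of [:: (v, w)].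

Lemma tpure_bilin : bilin tpure_fun.
Proof.
split=> [w c v v'|v c w w']; apply: tens_ext => U f;
  rewrite tens_sum_linear !tens_sum_of !big_seq1 /=.
  by rewrite linearPl.
by rewrite linearPr.
Qed.

Definition tpure : {bilinear V -> W -> tens} := mk_bilinear tpure_bilin.

Lemma tens_liftE (U : lmodType k) (f : {bilinear V -> W -> U}) v w :
  tens_lift f (tpure v w) = f v w.
Proof. by rewrite mk_linearE mk_bilinearE tens_sum_of big_seq1. Qed.

Lemma tens_liftB (U : lmodType k) (f : V -> W -> U) (fB : bilin f) v w :
  tens_lift (mk_bilinear fB) (tpure v w) = f v w.
Proof. by rewrite tens_liftE mk_bilinearE. Qed.

Lemma tens_gen (x : tens) :
  exists s : seq (V * W), x = \sum_(p <- s) tpure p.1 p.2.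
Proof.
exists (tens_repr x); apply: tens_ext => U f.
rewrite {1}/tens_sum -lock -(mk_linearE (tens_sum_linear f)) linear_sum; apply: eq_bigr => p _.
by rewrite tens_liftE.
Qed.

Lemma eq_tens_lin (U : lmodType k) (f g : {linear tens -> U}) :
  (forall v w, f (tpure v w) = g (tpure v w)) -> f =1 g.
Proof.
by move=> fg x; have [s ->] := tens_gen x; rewrite !linear_sum; apply: eq_bigr.
Qed.

End TensorProduct.

Arguments tpure {k V W}.
Notation "V ⊗ W" := (tens V W) (at level 40, left associativity).
Notation "v *t w" := (tpure v w) (at level 40, left associativity) : ring_scope.

Section TensorMaps.
Variable k : fieldType.
Implicit Types A B C : lmodType k.

Lemma tmap_bilin A A' B B' (f : {linear A -> A'}) (g : {linear B -> B'}) :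
  bilin (fun a b => f a *t g b).
Proof.
by split=> [b c a a'|a c b b']; [rewrite (linearP f) linearPl | rewrite (linearP g) linearPr].
Qed.

Definition tmap A A' B B' (f : {linear A -> A'}) (g : {linear B -> B'}) :
    {linear A ⊗ B -> A' ⊗ B'} :=
  tens_lift (mk_bilinear (tmap_bilin f g)).

Lemma tmapE A A' B B' (f : {linear A -> A'}) (g : {linear B -> B'}) a b :
  tmap f g (a *t b) = f a *t g b.
Proof. by rewrite tens_liftB. Qed.

Lemma tassoc1_bilin A B C (c : C) : bilin (fun (a : A) (b : B) => a *t (b *t c)).
Proof.
split=> [b x a a'|a x b b'].
  by rewrite linearPl.
by rewrite linearPl linearPr.
Qed.

Lemma tassoc_bilin A B C :
  bilin (fun (x : A ⊗ B) (c : C) => tens_lift (mk_bilinear (@tassoc1_bilin A B C c)) x).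
Proof.
split=> [c y x x'|x y c c']; first by rewrite [LHS]linearP.
have [s ->] := tens_gen x.
rewrite !linear_sum -big_split; apply: eq_bigr => p _.
by rewrite !tens_liftB !linearPr.
Qed.

Definition tassoc A B C : {linear (A ⊗ B) ⊗ C -> A ⊗ (B ⊗ C)} :=
  tens_lift (mk_bilinear (@tassoc_bilin A B C)).

Lemma tassocE A B C (a : A) (b : B) (c : C) :
  tassoc A B C (a *t b *t c) = a *t (b *t c).
Proof. by rewrite tens_liftB tens_liftB. Qed.

End TensorMaps.

Section Decomposition.
Variables (k : fieldType) (V : lmodType k).
Implicit Types (pr : int -> {linear V -> V}) (v w : V).

Definition orthogonal_idem pr : Prop :=
  forall i j v, pr i (pr j v) = if i == j then pr j v else 0.

Definition decomposes pr v : Prop :=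
  exists2 s : seq int, uniq s & v = \sum_(i <- s) pr i v.

Lemma pr_notin pr v s : orthogonal_idem pr -> v = \sum_(i <- s) pr i v ->
  forall j, j \notin s -> pr j v = 0.
Proof.
move=> prI -> j js; rewrite linear_sum big_seq big1 // => i is_.
by rewrite prI; case: eqP js => // ->; rewrite is_.
Qed.

Lemma big_widen (U : lmodType k) (F : int -> U) (s t : seq int) :
    uniq s -> uniq t -> {subset s <= t} -> (forall i, i \notin s -> F i = 0) ->
  \sum_(i <- s) F i = \sum_(i <- t) F i.
Proof.
move=> us ut st F0; rewrite [RHS](bigID (mem s)) /= [X in _ + X]big1 // addr0.
rewrite -[in RHS]big_filter; apply/perm_big/uniq_perm; rewrite ?filter_uniq//.
by move=> i; rewrite mem_filter /=; case: (boolP (i \in s)) => // /st.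
Qed.

Lemma decomposesD pr v w : orthogonal_idem pr ->
  decomposes pr v -> decomposes pr w -> decomposes pr (v + w).
Proof.
move=> prI [s us vs] [t ut wt]; exists (undup (s ++ t)); first exact: undup_uniq.
under eq_bigr do rewrite linearD.
rewrite big_split {1}vs {1}wt; congr (_ + _); apply: big_widen;
  rewrite ?undup_uniq //.
- by move=> i; rewrite mem_undup mem_cat => ->.
- exact: pr_notin.
- by move=> i; rewrite mem_undup mem_cat orbC => ->.
- exact: pr_notin.
Qed.

Lemma decomposes0 pr : decomposes pr 0.
Proof. by exists [::] => //; rewrite big_nil. Qed.

Lemma decomposes_homog pr i v : pr i v = v -> decomposes pr v.
Proof. by exists [:: i] => //; rewrite big_seq1. Qed.

Lemma decomposes_sum pr (I : Type) (s : seq I) (F : I -> V) :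
    orthogonal_idem pr -> (forall i, decomposes pr (F i)) ->
  decomposes pr (\sum_(i <- s) F i).
Proof.
move=> prI FD; elim: s => [|i s IH]; first by rewrite big_nil; exact: decomposes0.
by rewrite big_cons; apply: decomposesD.
Qed.

End Decomposition.

(* A Z-graded complex is an internal direct sum: [gpr i] is the projection
   onto the summand of degree [i]. *)
Record cochain (k : fieldType) := Cochain {
  cmod :> lmodType k;
  gpr : int -> {linear cmod -> cmod};
  gpr_idem : orthogonal_idem gpr;
  gpr_dec : forall v, decomposes gpr v;
  cd : {linear cmod -> cmod};
  cd_deg : forall i v, gpr i v = v -> gpr (i + 1) (cd v) = cd v;
  cd_cd : forall v, cd (cd v) = 0
}.

Arguments gpr {k}.
Arguments cd {k c}.

Definition homog (k : fieldType) (K : cochain k) (i : int) (v : K) : Prop :=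
  gpr K i v = v.

Definition of_degree (k : fieldType) (K L : cochain k) (n : int) (f : K -> L) : Prop :=
  forall i v, homog i v -> homog (i + n) (f v).

Definition cochain_map (k : fieldType) (K L : cochain k) (f : K -> L) : Prop :=
  of_degree 0 f /\ forall v, f (cd v) = cd (f v).

Section Graded.
Variables (k : fieldType) (K : cochain k).
Implicit Types (U : lmodType k) (v : K).

Lemma homog_gpr i v : homog i (gpr K i v).
Proof. by rewrite /homog gpr_idem eqxx. Qed.

Lemma homog_gprE i j v : homog j v -> gpr K i v = if i == j then v else 0.
Proof. by move=> vj; rewrite -{1}vj gpr_idem vj. Qed.

Definition gsupp v : seq int := s2val (cid2 (gpr_dec v)).

Definition gsum U (F : int -> {linear K -> U}) v : U :=
  \sum_(i <- gsupp v) F i (gpr K i v).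

Lemma gsumE U (F : int -> {linear K -> U}) v s :
    uniq s -> v = \sum_(i <- s) gpr K i v ->
  gsum F v = \sum_(i <- s) F i (gpr K i v).
Proof.
rewrite /gsum /gsupp; case: (cid2 _) => t /= ut vt us vs.
have pr0 t' : v = \sum_(i <- t') gpr K i v ->
    forall i, i \notin t' -> F i (gpr K i v) = 0.
  by move=> vt' i it; rewrite (pr_notin (@gpr_idem _ K) vt' it) linear0.
rewrite (@big_widen _ _ _ t (undup (s ++ t))) ?undup_uniq //; last exact: pr0.
  rewrite [RHS](@big_widen _ _ _ s (undup (s ++ t))) ?undup_uniq //; last exact: pr0.
  by move=> i; rewrite mem_undup mem_cat => ->.
by move=> i; rewrite mem_undup mem_cat orbC => ->.
Qed.

Lemma gsum_homog U (F : int -> {linear K -> U}) i v : homog i v -> gsum F v = F i v.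
Proof. by move=> vi; rewrite (@gsumE _ _ _ [:: i]) ?big_seq1 ?vi. Qed.

Lemma gsum_linear U (F : int -> {linear K -> U}) : linear (gsum F).
Proof.
move=> c v w; have [s us vs] := gpr_dec v; have [t ut wt] := gpr_dec w.
pose r := undup (s ++ t).
have vr : v = \sum_(i <- r) gpr K i v.
  rewrite {1}vs; apply: big_widen; rewrite ?undup_uniq //.
    by move=> i; rewrite mem_undup mem_cat => ->.
  exact: (pr_notin (@gpr_idem _ K) vs).
have wr : w = \sum_(i <- r) gpr K i w.
  rewrite {1}wt; apply: big_widen; rewrite ?undup_uniq //.
    by move=> i; rewrite mem_undup mem_cat orbC => ->.
  exact: (pr_notin (@gpr_idem _ K) wt).
rewrite !(@gsumE _ F _ r) ?undup_uniq //.
  by rewrite scaler_sumr -big_split; apply: eq_bigr => i _; rewrite !linearP.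
rewrite {1}vr {1}wr scaler_sumr -big_split; apply: eq_bigr => i _.
by rewrite linearP.
Qed.

Lemma eq_homog U (f g : {linear K -> U}) :
  (forall i v, homog i v -> f v = g v) -> f =1 g.
Proof.
move=> fg v; have [s _ ->] := gpr_dec v; rewrite !linear_sum.
by apply: eq_bigr => i _; apply: fg (homog_gpr i v).
Qed.

(* The linear involution v |-> (-1)^|v| v. *)
Definition gsign : {linear K -> K} :=
  mk_linear (gsum_linear (fun i => (-1) ^ i \*: idfun)).

Lemma gsignE i v : homog i v -> gsign v = (-1) ^ i *: v.
Proof. exact: gsum_homog. Qed.

End Graded.

Section TensorComplex.
Variables (k : fieldType) (K L : cochain k).

Lemma eq_tens_homog (U : lmodType k) (f g : {linear K ⊗ L -> U}) :
    (forall i j v w, homog i v -> homog j w -> f (v *t w) = g (v *t w)) ->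
  f =1 g.
Proof.
move=> fg; apply: eq_tens_lin => v w.
have [s _ ->] := gpr_dec v; have [t _ ->] := gpr_dec w.
rewrite linear_sumlz !(linear_sum _ s); apply: eq_bigr => i _.
rewrite linear_sumr !(linear_sum _ t); apply: eq_bigr => j _.
by apply: fg; exact: homog_gpr.
Qed.

Lemma tpurel_linear (w : L) : linear (fun v : K => v *t w).
Proof. by move=> c v v'; rewrite linearPl. Qed.

Lemma tens_gpr_bilin n :
  bilin (fun (v : K) (w : L) =>
    gsum (fun i => mk_linear (tpurel_linear (gpr L (n - i) w))) v).
Proof.
split=> [w c v v'|v c w w']; first exact: gsum_linear.
rewrite /gsum scaler_sumr -big_split; apply: eq_bigr => i _.
by rewrite linearP !mk_linearE linearPr.
Qed.

Definition tens_gpr n : {linear K ⊗ L -> K ⊗ L} :=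
  tens_lift (mk_bilinear (tens_gpr_bilin n)).

Lemma tens_gprE n i j v w : homog i v -> homog j w ->
  tens_gpr n (v *t w) = if n == i + j then v *t w else 0.
Proof.
move=> vi wj; rewrite tens_liftB (gsum_homog _ vi) mk_linearE.
rewrite (homog_gprE _ wj) subr_eq addrC.
by case: eqP => // _; rewrite linear0r.
Qed.

Lemma tens_gpr_idem : orthogonal_idem tens_gpr.
Proof.
move=> m n; case: eqP => [<-|mn] x.
  apply: (eq_tens_homog (f := tens_gpr m \o tens_gpr m)) => i j v w vi wj /=.
  rewrite (tens_gprE _ vi wj); case: eqP => [e|_]; last by rewrite linear0.
  by rewrite (tens_gprE _ vi wj) e eqxx.
apply: (eq_tens_homog (f := tens_gpr m \o tens_gpr n) (g := \0)).
move=> i j v w vi wj /=.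
rewrite (tens_gprE _ vi wj); case: eqP => [e|_]; last by rewrite linear0.
by rewrite (tens_gprE _ vi wj) -e; case: eqP mn.
Qed.

Lemma tens_gpr_dec x : decomposes tens_gpr x.
Proof.
have [s ->] := tens_gen x; apply: decomposes_sum tens_gpr_idem _ => p.
have [t _ ->] := gpr_dec p.1; have [u _ ->] := gpr_dec p.2.
rewrite linear_sumlz; apply: decomposes_sum tens_gpr_idem _ => i.
rewrite linear_sumr; apply: decomposes_sum tens_gpr_idem _ => j.
apply: (@decomposes_homog _ _ _ (i + j)).
by rewrite (tens_gprE _ (homog_gpr _ _) (homog_gpr _ _)) eqxx.
Qed.

Definition tens_cd : {linear K ⊗ L -> K ⊗ L} :=
  tmap cd idfun \+ tmap (@gsign k K) cd.

Lemma tens_cdE i v w : homog i v ->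
  tens_cd (v *t w) = cd v *t w + (-1) ^ i *: (v *t cd w).
Proof. by move=> vi; rewrite /= !tmapE (gsignE vi) linearZl_LR. Qed.

Lemma tens_cd_deg n x : tens_gpr n x = x -> tens_gpr (n + 1) (tens_cd x) = tens_cd x.
Proof.
move: (tens_cd) tens_cdE => D DE xn; rewrite -xn.
apply: (eq_tens_homog (f := tens_gpr (n + 1) \o D \o tens_gpr n)
                      (g := D \o tens_gpr n)) => i j v w vi wj /=.
rewrite (tens_gprE _ vi wj); case: eqP => [->|_]; last by rewrite !linear0.
rewrite (DE _ _ _ vi) linearD linearZ /=.
rewrite (tens_gprE _ (cd_deg vi) wj) (tens_gprE _ vi (cd_deg wj)).
by rewrite addrA eqxx addrAC eqxx.
Qed.

Lemma tens_cd_cd x : tens_cd (tens_cd x) = 0.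
Proof.
move: (tens_cd) tens_cdE => D DE.
apply: (eq_tens_homog (f := D \o D) (g := \0)) => i j v w vi wj /=.
rewrite (DE _ _ _ vi) linearD linearZ /= (DE _ _ _ (cd_deg vi)) (DE _ _ _ vi).
rewrite !cd_cd linear0l linear0r scaler0 addr0 add0r -scalerDl.
by rewrite exprzDr ?unitrN1 // expr1z mulrN1 addNr scale0r.
Qed.

Lemma tens_gpr_comm (M : cochain k) (f : {linear K ⊗ L -> M}) :
    (forall i j v w, homog i v -> homog j w -> homog (i + j) (f (v *t w))) ->
  forall n x, gpr M n (f x) = f (tens_gpr n x).
Proof.
move=> fh n; apply: (eq_tens_homog (f := gpr M n \o f) (g := f \o tens_gpr n)).
move=> i j v w vi wj /=; rewrite (tens_gprE _ vi wj) (homog_gprE _ (fh _ _ _ _ vi wj)).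
by case: eqP; rewrite ?linear0.
Qed.

Definition tens_cochain : cochain k :=
  Cochain tens_gpr_idem tens_gpr_dec tens_cd_deg tens_cd_cd.

End TensorComplex.

Notation "K ⊗c L" := (tens_cochain K L) (at level 40, left associativity).

Lemma homog_tpure (k : fieldType) (K L : cochain k) i j (v : K) (w : L) :
  homog i v -> homog j w -> homog (K := K ⊗c L) (i + j) (v *t w).
Proof. by move=> vi wj; rewrite /homog /= (tens_gprE _ vi wj) eqxx. Qed.

Lemma cd_tpure (k : fieldType) (K L : cochain k) i (v : K) (w : L) : homog i v ->
  cd (c := K ⊗c L) (v *t w) = cd v *t w + (-1) ^ i *: (v *t cd w).
Proof. exact: tens_cdE. Qed.

Lemma eq_tens_homog3 (k : fieldType) (K L M : cochain k) (U : lmodType k)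
    (f g : {linear K ⊗ (L ⊗ M) -> U}) :
    (forall i j l u v w, homog i u -> homog j v -> homog l w ->
       f (u *t (v *t w)) = g (u *t (v *t w))) ->
  f =1 g.
Proof.
move=> fg; apply: (@eq_tens_homog _ K (L ⊗c M)) => i _ u y ui _.
apply: (eq_tens_homog (f := f \o tpure u) (g := g \o tpure u)).
by move=> j l v w vj wl; apply: fg ui vj wl.
Qed.

Section UnitComplex.
Variable k : fieldType.

Definition unit_gpr (i : int) : {linear k^o -> k^o} := 
  if i == 0 then [the {linear k^o -> k^o} of idfun]
  else [the {linear k^o -> k^o} of \0].

Lemma unit_gpr_idem : orthogonal_idem unit_gpr.
Proof.
move=> i j v; rewrite /unit_gpr; have [-> | _] := eqVneq j 0; first by case: eqP.
by rewrite linear0; case: eqP.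
Qed.

Lemma unit_gpr_dec v : decomposes unit_gpr v.
Proof. exact: (@decomposes_homog _ _ _ 0). Qed.

Definition unit_cd : {linear k^o -> k^o} := \0.

Lemma unit_cd_deg i v : unit_gpr i v = v -> unit_gpr (i + 1) (unit_cd v) = unit_cd v.
Proof. by move=> _; rewrite linear0. Qed.

Lemma unit_cd_cd v : unit_cd (unit_cd v) = 0.
Proof. by []. Qed.

Definition unit_cochain : cochain k :=
  Cochain unit_gpr_idem unit_gpr_dec unit_cd_deg unit_cd_cd.

End UnitComplex.

(* An associative unital algebra, in which 1 = 0 is allowed. *)
Record dga (k : fieldType) := Dga {
  dga_cochain :> cochain k;
  dmul : {bilinear dga_cochain -> dga_cochain -> dga_cochain};
  dunit : dga_cochain;
  dmulA : associative dmul;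
  dmul1l : left_id dunit dmul;
  dmul1r : right_id dunit dmul;
  dunit_homog : homog 0 dunit;
  dmul_homog : forall i j a b,
    homog i a -> homog j b -> homog (i + j) (dmul a b);
  cd_dmul : forall i a b, homog i a ->
    cd (dmul a b) = dmul (cd a) b + (-1) ^ i *: dmul a (cd b)
}.

Arguments dmul {k d}.

Section Bar.
Variables (k : fieldType) (Omega : dga k).

(* [tpow n] is the (n+1)-fold tensor power of Omega, nested to the right. *)
Fixpoint tpow (n : nat) : cochain k :=
  if n is n'.+1 then Omega ⊗c tpow n' else Omega.

Definition tmul : {linear Omega ⊗ Omega -> Omega} := tens_lift dmul.

Definition tmul1_fun (X : lmodType k) (a : Omega) : {linear Omega ⊗ X -> Omega ⊗ X} :=
  tmap (dmul a) idfun.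

(* a ⊗ (b ⊗ x) |-> ab ⊗ x *)
Lemma tmull_bilin (X : lmodType k) : bilin (fun (a : Omega) (y : Omega ⊗ X) =>
  tmul1_fun X a y).
Proof.
split=> [y c a a'|a c y y']; last exact: linearP.
apply: (eq_tens_lin (f := tmul1_fun X (c *: a + a'))
  (g := c \*: tmul1_fun X a \+ tmul1_fun X a')) => b x.
rewrite [LHS]tmapE [X in X *t _]linearPl linearPl.
by rewrite -[RHS]/(c *: tmul1_fun X a _ + tmul1_fun X a' _) !tmapE.
Qed.

Definition tmull (X : lmodType k) : {linear Omega ⊗ (Omega ⊗ X) -> Omega ⊗ X} :=
  tens_lift (mk_bilinear (@tmull_bilin X)).

Lemma tmulE a b : tmul (a *t b) = dmul a b.
Proof. by rewrite tens_liftE. Qed.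

Lemma tmullE (X : lmodType k) a b (x : X) :
  tmull X (a *t (b *t x)) = dmul a b *t x.
Proof. by rewrite tens_liftB tmapE. Qed.

(* a_1 ⊗ ... ⊗ a_(n+2) |->
     \sum_(1 <= i < n+2) (-1)^(i-1) a_1 ⊗ ... ⊗ a_i a_(i+1) ⊗ ... ⊗ a_(n+2) *)
Fixpoint bar_mul (n : nat) : {linear tpow n.+1 -> tpow n} :=
  match n return {linear tpow n.+1 -> tpow n} with
  | 0 => tmul
  | n'.+1 => tmull (tpow n') \- tmap idfun (bar_mul n')
  end.


Lemma bar_mul0E a b : bar_mul 0 (a *t b) = dmul a b.
Proof. exact: tmulE. Qed.

Lemma bar_mulSE n a b (x : tpow n) :
  bar_mul n.+1 (a *t (b *t x)) = dmul a b *t x - a *t bar_mul n (b *t x).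
Proof.
rewrite -[LHS]/(tmull _ _ - tmap idfun (bar_mul n) (a *t (b *t x))).
by rewrite tmullE tmapE.
Qed.

Fixpoint tpow_pure (n : nat) (a : nat -> Omega) : tpow n :=
  match n return tpow n with
  | 0 => a 0%N
  | n'.+1 => a 0%N *t tpow_pure n' (fun i => a i.+1)
  end.

Lemma bar_mul_pure n (a : nat -> Omega) :
  bar_mul n (tpow_pure n.+1 a) =
  \sum_(i < n.+1) (-1) ^+ i *: tpow_pure n (fun j =>
     if (j < i)%N then a j
     else if j == i :> nat then dmul (a i) (a i.+1) else a j.+1).
Proof.
elim: n a => [|n IH] a; first by rewrite big_ord1 bar_mul0E scale1r.
rewrite [LHS]bar_mulSE big_ord_recl scale1r; congr (_ + _).
have -> : a 1%N *t tpow_pure n (fun i => a i.+2) = tpow_pure n.+1 (fun i => a i.+1).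
  by [].
rewrite IH linear_sumr -sumrN; apply: eq_bigr => i _.
by rewrite exprS mulN1r scaleNr linearZr_LR.
Qed.

Lemma cd_tpow_pure n (a : nat -> Omega) (deg : nat -> int) :
    (forall i, homog (deg i) (a i)) ->
  cd (tpow_pure n a) =
  \sum_(i < n.+1) (-1) ^ (\sum_(j < i) deg j) *:
    tpow_pure n (fun j => if j == i :> nat then cd (a j) else a j).
Proof.
elim: n a deg => [|n IH] a deg ad; first by rewrite big_ord1 big_ord0 scale1r.
rewrite (cd_tpure _ (ad 0%N)) big_ord_recl big_ord0 scale1r; congr (_ + _).
rewrite (IH _ (fun i => deg i.+1)) // linear_sumr scaler_sumr.
apply: eq_bigr => i _; rewrite big_ord_recl exprzDr ?unitrN1 // -scalerA.
by congr (_ *: _); rewrite linearZr_LR.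
Qed.

Lemma homog_tpow_pure n (a : nat -> Omega) (deg : nat -> int) :
    (forall i, homog (deg i) (a i)) ->
  homog (\sum_(i < n.+1) deg i) (tpow_pure n a).
Proof.
elim: n a deg => [|n IH] a deg ad; first by rewrite big_ord1.
by rewrite big_ord_recl; apply: homog_tpure => //; apply: (IH _ (fun i => deg i.+1)).
Qed.

Lemma gpr_tmull (L : cochain k) m y :
  gpr (Omega ⊗c L) m (tmull L y) = tmull L (gpr (Omega ⊗c (Omega ⊗c L)) m y).
Proof.
apply: (eq_tens_homog3 (f := gpr (Omega ⊗c L) m \o tmull L)
  (g := tmull L \o gpr (Omega ⊗c (Omega ⊗c L)) m)) => i j l a b x ai bj xl.
rewrite -[LHS]/(gpr (Omega ⊗c L) m (tmull L _)).
rewrite -[RHS]/(tmull L (gpr (Omega ⊗c (Omega ⊗c L)) m _)) tmullE.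
rewrite (homog_gprE _ (homog_tpure (dmul_homog ai bj) xl)).
rewrite (homog_gprE _ (homog_tpure ai (homog_tpure bj xl))) addrA.
by case: eqP => _; rewrite ?linear0 ?tmullE.
Qed.

Lemma gpr_tmap1 (L M : cochain k) (g : {linear L -> M}) :
    (forall m y, gpr M m (g y) = g (gpr L m y)) ->
  forall m y, gpr (Omega ⊗c M) m (tmap idfun g y) =
              tmap idfun g (gpr (Omega ⊗c L) m y).
Proof.
move=> gh; apply: (tens_gpr_comm (M := Omega ⊗c M)) => i j a y ai yj.
by rewrite tmapE; apply: homog_tpure => //; rewrite /homog gh yj.
Qed.

Lemma gpr_bar_mul n m y :
  gpr (tpow n) m (bar_mul n y) = bar_mul n (gpr (tpow n.+1) m y).
Proof.
elim: n m y => [|n IH] m y.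
  apply: tens_gpr_comm => i j a b ai bj.
  by rewrite bar_mul0E; apply: dmul_homog.
rewrite -[bar_mul _ y]/(tmull _ y - tmap idfun (bar_mul n) y) linearB.
by rewrite [X in X - _]gpr_tmull [X in _ - X](gpr_tmap1 IH).
Qed.

Lemma cd_tmull (L : cochain k) y :
  cd (c := Omega ⊗c L) (tmull L y) = tmull L (cd (c := Omega ⊗c (Omega ⊗c L)) y).
Proof.
apply: (eq_tens_homog3 (f := cd (c := Omega ⊗c L) \o tmull L)
  (g := tmull L \o cd (c := Omega ⊗c (Omega ⊗c L)))) => i j l a b x ai bj xl.
rewrite -[LHS]/(cd (c := Omega ⊗c L) (tmull L _)).
rewrite -[RHS]/(tmull L (cd (c := Omega ⊗c (Omega ⊗c L)) _)) tmullE.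
rewrite (cd_tpure _ (dmul_homog ai bj)) (cd_dmul _ ai).
rewrite (cd_tpure _ ai) (cd_tpure _ bj).
rewrite linearD linearZ /= tmullE linearDr [in RHS]linearD.
rewrite linearZr_LR linearZ /= !tmullE.
by rewrite linearDl linearZl_LR scalerDr scalerA exprzDr ?unitrN1 // addrA.
Qed.

Lemma cd_tmap1 (L M : cochain k) (g : {linear L -> M}) :
    (forall y, cd (g y) = g (cd y)) ->
  forall y, cd (c := Omega ⊗c M) (tmap idfun g y) =
            tmap idfun g (cd (c := Omega ⊗c L) y).
Proof.
move=> gd; apply: (eq_tens_homog (f := cd (c := Omega ⊗c M) \o tmap idfun g)
  (g := tmap idfun g \o cd (c := Omega ⊗c L))) => i j a y ai yj.
rewrite -[LHS]/(cd (c := Omega ⊗c M) (tmap idfun g _)).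
rewrite -[RHS]/(tmap idfun g (cd (c := Omega ⊗c L) _)) tmapE.
rewrite (cd_tpure _ ai) (cd_tpure _ ai).
by rewrite linearD linearZ /= !tmapE gd.
Qed.

Lemma cd_bar_mul n y : cd (bar_mul n y) = bar_mul n (cd y).
Proof.
elim: n y => [|n IH] y.
  apply: (eq_tens_homog (f := cd \o bar_mul 0)
    (g := bar_mul 0 \o cd (c := Omega ⊗c Omega))) => i j a b ai bj.
  rewrite -[LHS]/(cd (bar_mul 0 _)) -[RHS]/(bar_mul 0 (cd (c := Omega ⊗c Omega) _)) bar_mul0E.
  rewrite (cd_tpure _ ai) linearD linearZ.
  by rewrite !bar_mul0E (cd_dmul _ ai).
rewrite -[bar_mul _ y]/(tmull _ y - tmap idfun (bar_mul n) y) linearB.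
by rewrite [X in X - _]cd_tmull [X in _ - X](cd_tmap1 IH).
Qed.

Lemma bar_mul_mul n y : bar_mul n (bar_mul n.+1 y) = 0.
Proof.
elim: n y => [|n IH] y.
  apply: (eq_tens_homog3 (f := bar_mul 0 \o bar_mul 1) (g := \0)).
  move=> i j l a b c _ _ _; rewrite -[LHS]/(bar_mul 0 (bar_mul 1 _)) bar_mulSE.
  by rewrite linearB !bar_mul0E dmulA subrr.
apply: (eq_tens_lin (f := bar_mul n.+1 \o bar_mul n.+2) (g := \0)) => a y'.
apply: (eq_tens_homog3 (f := bar_mul n.+1 \o bar_mul n.+2 \o tpure a) (g := \0)).
move=> i j l b c x _ _ _.
rewrite -[LHS]/(bar_mul n.+1 (bar_mul n.+2 _)) [RHS]/=.
rewrite bar_mulSE linearB bar_mulSE.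
pose w := bar_mul n.+1 (b *t (c *t x)).
rewrite -[X in _ - X]/(tmull _ (a *t w) - tmap idfun (bar_mul n) (a *t w)).
rewrite tmapE IH linear0r subr0 /w bar_mulSE linearBr linearB !tmullE dmulA.
by rewrite subrr.
Qed.

End Bar.

Section DirectSum.
Variables (k : fieldType) (V : nat -> lmodType k).

Record dsum_type := DSum {
  dsum_val :> forall n, V n;
  dsum_fin : exists N, forall n, (N <= n)%N -> dsum_val n = 0
}.

HB.instance Definition _ := gen_eqMixin dsum_type.
HB.instance Definition _ := gen_choiceMixin dsum_type.

Implicit Types f g : dsum_type.

Lemma dsum_ext f g : (forall n, f n = g n) -> f = g.
Proof.
case: f g => [f ff] [g gf] /= fg; have e : f = g by apply: functional_extensionality_dep.
by subst g; congr DSum; apply: Prop_irrelevance.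
Qed.

Lemma dsum0_fin : exists N, forall n, (N <= n)%N -> 0 = 0 :> V n.
Proof. by exists 0%N. Qed.

Lemma dsum_add_fin f g :
  exists N, forall n, (N <= n)%N -> f n + g n = 0.
Proof.
have [[M fM] [N gN]] := (dsum_fin f, dsum_fin g).
by exists (maxn M N) => n; rewrite geq_max => /andP[? ?]; rewrite fM ?gN ?addr0.
Qed.

Lemma dsum_scale_fin c f : exists N, forall n, (N <= n)%N -> c *: f n = 0.
Proof. by have [N fN] := dsum_fin f; exists N => n ?; rewrite fN ?scaler0. Qed.

Definition dsum0 := DSum dsum0_fin.
Definition dsum_add f g := DSum (dsum_add_fin f g).
Definition dsum_scale c f := DSum (dsum_scale_fin c f).

Lemma dsum_addA : associative dsum_add.
Proof. by move=> f g h; apply: dsum_ext => n; apply: addrA. Qed.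
Lemma dsum_addC : commutative dsum_add.
Proof. by move=> f g; apply: dsum_ext => n; apply: addrC. Qed.
Lemma dsum_add0 : left_id dsum0 dsum_add.
Proof. by move=> f; apply: dsum_ext => n; apply: add0r. Qed.
Lemma dsum_addN : left_inverse dsum0 (dsum_scale (-1)) dsum_add.
Proof. by move=> f; apply: dsum_ext => n; rewrite /= scaleN1r addNr. Qed.

HB.instance Definition _ :=
  GRing.isZmodule.Build dsum_type dsum_addA dsum_addC dsum_add0 dsum_addN.

Lemma dsum_scaleA a b f : dsum_scale a (dsum_scale b f) = dsum_scale (a * b) f.
Proof. by apply: dsum_ext => n; apply: scalerA. Qed.
Lemma dsum_scale1 : left_id 1 dsum_scale.
Proof. by move=> f; apply: dsum_ext => n; apply: scale1r. Qed.
Lemma dsum_scaleDr : right_distributive dsum_scale +%R.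
Proof. by move=> a f g; apply: dsum_ext => n; apply: scalerDr. Qed.
Lemma dsum_scaleDl f : {morph dsum_scale^~ f : a b / a + b}.
Proof. by move=> a b; apply: dsum_ext => n; apply: scalerDl. Qed.

HB.instance Definition _ := GRing.Zmodule_isLmodule.Build k dsum_type
  dsum_scaleA dsum_scale1 dsum_scaleDr dsum_scaleDl.

Definition dsum : lmodType k := dsum_type.

Lemma dsum_val_linear n : linear (fun f : dsum => dsum_val f n).
Proof. by []. Qed.

Definition dcomp n : {linear dsum -> V n} := mk_linear (dsum_val_linear n).

Lemma dcompE n (f : dsum) : dcomp n f = f n.
Proof. by rewrite mk_linearE. Qed.

Definition dinj_val n (x : V n) (m : nat) : V m :=
  if n =P m is ReflectT e then ecast m (V m) e x else 0.

Lemma dinj_fin n (x : V n) : exists N, forall m, (N <= m)%N -> dinj_val x m = 0.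
Proof.
exists n.+1 => m nm; rewrite /dinj_val; case: eqP => // e.
by rewrite e ltnn in nm.
Qed.

Lemma dinj_val_eq n (x : V n) : dinj_val x n = x.
Proof. by rewrite /dinj_val; case: eqP => // e; rewrite (eq_axiomK e). Qed.

Lemma dinj_val_neq n m (x : V n) : n != m -> dinj_val x m = 0.
Proof. by rewrite /dinj_val; case: eqP. Qed.

Lemma dinj_linear n : linear (fun x : V n => DSum (dinj_fin x) : dsum).
Proof.
move=> c x y; apply: dsum_ext => m.
rewrite -[RHS]/(c *: dinj_val x m + dinj_val y m) /= /dinj_val.
by case: eqP => [e|_]; [case: m / e | rewrite scaler0 addr0].
Qed.

Definition dinj n : {linear V n -> dsum} := mk_linear (@dinj_linear n).

Lemma dinjE n x : dinj n x n = x.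
Proof. by rewrite mk_linearE /= dinj_val_eq. Qed.

Lemma dinj_neq n m x : n != m -> dinj n x m = 0.
Proof. by move=> nm; rewrite mk_linearE /= dinj_val_neq. Qed.

Lemma dsum_eq (f : dsum) N : (forall n, (N <= n)%N -> f n = 0) ->
  f = \sum_(n < N) dinj n (f n).
Proof.
move=> fN; apply: dsum_ext => n; rewrite -[RHS]dcompE linear_sum.
have [nN|nN] := ltnP n N; last first.
  rewrite fN // big1 // => i _; rewrite dcompE dinj_neq //.
  by rewrite neq_ltn (leq_trans (ltn_ord i) nN).
rewrite (bigD1 (Ordinal nN)) //= dcompE dinjE big1 ?addr0 // => i.
by rewrite -val_eqE /= => ?; rewrite dcompE dinj_neq.
Qed.

End DirectSum.

Arguments dinj {k} V n.
Arguments dcomp {k} V n.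

Section BarComplex.
Variables (k : fieldType) (Omega : dga k).

Definition bar : lmodType k := dsum (fun n => tpow Omega n).

Lemma bar_gpr_fin (m : int) (f : bar) :
  exists N, forall n, (N <= n)%N -> gpr (tpow Omega n) (m + n.+1%:Z) (f n) = 0.
Proof. by have [N fN] := dsum_fin f; exists N => n ?; rewrite fN ?linear0. Qed.

Lemma bar_gpr_linear (m : int) :
  linear (fun f : bar => DSum (bar_gpr_fin m f) : bar).
Proof. by move=> c f g; apply: dsum_ext => n; apply: linearP. Qed.

(* a_1 ⊗ ... ⊗ a_(n+1) has degree \sum |a_i| - (n+1) *)
Definition bar_gpr (m : int) : {linear bar -> bar} := mk_linear (bar_gpr_linear m).

Lemma bar_gprE m (f : bar) n :
  bar_gpr m f n = gpr (tpow Omega n) (m + n.+1%:Z) (f n).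
Proof. by rewrite mk_linearE. Qed.

Lemma bar_gpr_idem : orthogonal_idem bar_gpr.
Proof.
move=> i j f; apply: dsum_ext => n; rewrite !bar_gprE gpr_idem.
by rewrite (inj_eq (addIr _)); case: eqP => // _; rewrite bar_gprE.
Qed.

Lemma bar_gpr_dinj m n (x : tpow Omega n) :
  homog (m + n.+1%:Z) x -> bar_gpr m (dinj _ n x) = dinj _ n x.
Proof.
move=> xm; apply: dsum_ext => l; rewrite bar_gprE.
have [<-|nl] := eqVneq n l; first by rewrite dinjE.
by rewrite dinj_neq // linear0.
Qed.

Lemma bar_gpr_dec f : decomposes bar_gpr f.
Proof.
have [N fN] := dsum_fin f; rewrite (dsum_eq fN).
apply: decomposes_sum bar_gpr_idem _ => n; have [s _ ->] := gpr_dec (f n).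
rewrite linear_sum; apply: decomposes_sum bar_gpr_idem _ => i.
apply: (@decomposes_homog _ _ _ (i - (val n).+1%:Z)).
by apply: bar_gpr_dinj; rewrite subrK; apply: homog_gpr.
Qed.

Lemma bar_cd_fin (f : bar) : exists N, forall n, (N <= n)%N ->
  (-1) ^+ n.+1 *: cd (f n) - (-1) ^+ n.+2 *: bar_mul Omega n (f n.+1) = 0.
Proof.
have [N fN] := dsum_fin f; exists N => n Nn.
by rewrite (fN n Nn) (fN n.+1 (leqW Nn)) (linear0 cd) (linear0 (bar_mul Omega n)) !scaler0 subr0.
Qed.

Lemma bar_cd_linear : linear (fun f : bar => DSum (bar_cd_fin f) : bar).
Proof.
move=> c f g; apply: dsum_ext => n.
have E m : dsum_val (c *: f + g) m = c *: f m + g m by [].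
pose D (h : bar) := (-1) ^+ n.+1 *: cd (h n) - (-1) ^+ n.+2 *: bar_mul Omega n (h n.+1).
rewrite -[LHS]/(D (c *: f + g)) -[RHS]/(c *: D f + D g) /D !E (linearP cd) (linearP (bar_mul Omega n)) /=.
rewrite !scalerDr !scalerN opprD !scalerA addrACA.
by rewrite [c * _]mulrC [c * _]mulrC.
Qed.

(* With [n.+1] tensor factors, [cd] on [tpow n] carries the internal signs
   (-1)^(|a_1|+...+|a_(i-1)|) and [bar_mul] the signs (-1)^(i-1); see
   [cd_tpow_pure] and [bar_mul_pure]. *)
Definition bar_cd : {linear bar -> bar} := mk_linear bar_cd_linear.

Lemma bar_cdE (f : bar) n : bar_cd f n =
  (-1) ^+ n.+1 *: cd (f n) - (-1) ^+ n.+2 *: bar_mul Omega n (f n.+1).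
Proof. by rewrite mk_linearE. Qed.

Lemma bar_cd_deg m f : bar_gpr m f = f -> bar_gpr (m + 1) (bar_cd f) = bar_cd f.
Proof.
move=> fm; have fh n : homog (m + n.+1%:Z) (f n) by rewrite /homog -bar_gprE fm.
apply: dsum_ext => n; rewrite bar_gprE bar_cdE linearB !linearZ /=.
rewrite gpr_bar_mul addrAC (cd_deg (fh n)); congr (_ + _ *: - bar_mul _ _ _).
by rewrite -addrA -PoszD addn1 fh.
Qed.

Lemma bar_cd_cd f : bar_cd (bar_cd f) = 0.
Proof.
apply: dsum_ext => n; rewrite -[RHS]/(0 : tpow Omega n) !bar_cdE.
rewrite (linearB cd) !(linearZ_LR cd) (linearB (bar_mul Omega n)).
rewrite !(linearZ_LR (bar_mul Omega n)) cd_cd bar_mul_mul -cd_bar_mul.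
rewrite !scaler0 sub0r subr0 scalerN !scalerA -opprD -scalerDl.
by rewrite -mulrDl [(-1) ^+ n.+2]exprS mulN1r subrr mul0r scale0r oppr0.
Qed.

Definition bar_cochain : cochain k :=
  Cochain bar_gpr_idem bar_gpr_dec bar_cd_deg bar_cd_cd.

End BarComplex.

Section Twisting.
Variables (k : fieldType) (K : cochain k) (Omega : dga k).
Variables (eps : {linear K -> unit_cochain k}) (psi : {linear K -> K ⊗c Omega}).

Definition twisted_cd : {linear K ⊗c Omega -> K ⊗c Omega} :=
  tens_cd K Omega
    \+ (tmap idfun (tmul Omega) \o tassoc K Omega Omega \o tmap psi idfun).

Lemma twisted_cdE i a b : homog i a ->
  twisted_cd (a *t b) = cd a *t b + (-1) ^ i *: (a *t cd b)
    + tmap idfun (tmul Omega) (tassoc K Omega Omega (psi a *t b)).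
Proof.
move=> ai; rewrite -[LHS]/(tens_cd K Omega (a *t b) +
  tmap idfun (tmul Omega) (tassoc K Omega Omega (tmap psi idfun (a *t b)))).
by rewrite (tens_cdE _ ai) tmapE.
Qed.

Definition twisting_map : Prop :=
  of_degree 1 psi /\ forall x, twisted_cd (twisted_cd x) = 0.

Lemma eps_contract_bilin (X : lmodType k) :
  bilin (fun (a : K) (x : X) => (eps a : k) *: x).
Proof.
split=> [x c a b|a c x y]; first by rewrite linearP scalerDl -scalerA.
by rewrite scalerDr !scalerA mulrC.
Qed.

(* eps ⊗ 1, followed by the identification of k ⊗ X with X *)
Definition eps_contract (X : lmodType k) : {linear K ⊗ X -> X} :=
  tens_lift (mk_bilinear (@eps_contract_bilin X)).

(* [psi_iter n] is (psi ⊗ 1^n) ... (psi ⊗ 1) psi *)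
Fixpoint psi_iter (n : nat) : {linear K -> K ⊗ tpow Omega n} :=
  match n return {linear K -> K ⊗ tpow Omega n} with
  | 0 => psi
  | n'.+1 => tassoc K Omega (tpow Omega n') \o tmap psi idfun \o psi_iter n'
  end.

(* Since [tpow n] is the (n+1)-fold tensor power, [psi_part n] is psi_(n+1). *)
Definition psi_part (n : nat) : {linear K -> tpow Omega n} :=
  eps_contract (tpow Omega n) \o psi_iter n.

End Twisting.

(* Main.v *)
Require Import Defs.
From HB Require Import structures.
From mathcomp Require Import all_boot all_order all_algebra.

Set Implicit Arguments.
Unset Strict Implicit.
Unset Printing Implicit Defensive.

Import GRing.Theory.
Local Open Scope ring_scope.

(** Write T for (psi ⊗ 1) followed by reassociation, K ⊗ X -> K ⊗ (Ω ⊗ X), so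
    that the iterates P_n = [psi_iter psi n] satisfy P_(n+1) = T P_n.

    Applying the square of the twisted differential to a ⊗ 1, where d1 = 0,
    gives the Maurer-Cartan equation ([twisting_MC])
      psi d + d psi + (1 ⊗ m) T psi = 0.
    As psi has degree 1, the terms of T d + d T that differentiate the
    X-factor cancel, and the equation propagates to ([twist_cd])
      T d + d T = - (1 ⊗ μ) T T,
    where μ multiplies the first two factors of Ω ⊗ (Ω ⊗ X).  Since T acts on
    the left of the tensor, it commutes with operations on X.  Let b_n be the
    multiplication part of the bar differential from n+2 to n+1 factors; it
    satisfies b_(n+1) = μ - 1 ⊗ b_n.  Induction on n then gives
    ([psi_iter_cd])
      P_n d = (-1)^(n+1) (d P_n + (1 ⊗ b_n) P_(n+1)).
    Contracting the K-factor with the augmentation, which is a chain map,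
    turns this into the n-th component of the compatibility with the bar
    differential.  The sum over n makes sense because only finitely many
    components are nonzero at each element. *)

(** * Complements on algebras and tensor products *)

Lemma cd_dunit (k : fieldType) (Omega : dga k) : cd (dunit Omega) = 0.
Proof.
have := cd_dmul (dunit Omega) (dunit_homog Omega).
rewrite expr0z scale1r !dmul1l dmul1r => /eqP.
by rewrite -subr_eq subrr eq_sym => /eqP.
Qed.

Lemma eq_tens_homog3l (k : fieldType) (K L M : cochain k) (U : lmodType k)
    (f g : {linear (K ⊗ L) ⊗ M -> U}) :
    (forall i j l u v w, homog i u -> homog j v -> homog l w ->
       f (u *t v *t w) = g (u *t v *t w)) ->
  f =1 g.
Proof.
move=> fg; apply: (@eq_tens_homog _ (K ⊗c L) M) => _ l y w _ wl.
pose h : {linear K ⊗ L -> (K ⊗ L) ⊗ M} :=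
  mk_linear (@tpurel_linear _ (K ⊗c L) M w).
suff: f \o h =1 g \o h by move/(_ y); rewrite /= !mk_linearE.
apply: eq_tens_homog => i j u v ui vj /=; rewrite !mk_linearE; exact: fg ui vj wl.
Qed.

(** The degree of a linear map can be tested on pure tensors because the
    graded projections of a tensor product are determined by them. *)
Lemma of_degree_tens (k : fieldType) (K L M : cochain k) (n : int)
    (f : {linear K ⊗ L -> M}) :
    (forall i j v w, homog i v -> homog j w -> homog (i + j + n) (f (v *t w))) ->
  of_degree (K := K ⊗c L) n f.
Proof.
move=> fh m x <-.
apply: (eq_tens_homog (f := gpr M (m + n) \o f \o tens_gpr K L m)
                      (g := f \o tens_gpr K L m)) => i j v w vi wj /=.
rewrite (tens_gprE _ vi wj); case: eqP => [->|_]; last by rewrite !linear0.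
exact: fh.
Qed.

(** The same equation as [tassocE], with the left factor typed as the underlying
    module of a tensor complex: this is the form that [cd_tpure] and
    [homog_tpure] produce, and rewriting does not identify the two. *)
Lemma tassoc_cochainE (k : fieldType) (K L M : cochain k) (u : K) (v : L) (w : M) :
  tassoc K L M (tpure (V := K ⊗c L) (u *t v) w) = u *t (v *t w).
Proof. exact: tassocE. Qed.

Lemma of_degree_tassoc (k : fieldType) (K L M : cochain k) :
  of_degree (K := (K ⊗c L) ⊗c M) (L := K ⊗c (L ⊗c M)) 0 (tassoc K L M).
Proof.
move=> m x <-; rewrite addr0 /homog.
apply: (eq_tens_homog3l
  (f := gpr (K ⊗c (L ⊗c M)) m \o tassoc K L M \o gpr ((K ⊗c L) ⊗c M) m)
  (g := tassoc K L M \o gpr ((K ⊗c L) ⊗c M) m)) => i j l u v w ui vj wl.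
rewrite -[LHS]/(gpr (K ⊗c (L ⊗c M)) m (tassoc K L M (gpr ((K ⊗c L) ⊗c M) m _))).
rewrite -[RHS]/(tassoc K L M (gpr ((K ⊗c L) ⊗c M) m _)).
rewrite (homog_gprE _ (homog_tpure (homog_tpure ui vj) wl)).
case: eqP => [->|_]; last by rewrite !linear0.
by rewrite tassoc_cochainE -addrA; apply: homog_tpure ui (homog_tpure vj wl).
Qed.

Lemma cd_tassoc (k : fieldType) (K L M : cochain k) y :
  cd (c := K ⊗c (L ⊗c M)) (tassoc K L M y) =
  tassoc K L M (cd (c := (K ⊗c L) ⊗c M) y).
Proof.
apply: (eq_tens_homog3l (f := cd (c := K ⊗c (L ⊗c M)) \o tassoc K L M)
  (g := tassoc K L M \o cd (c := (K ⊗c L) ⊗c M))) => i j l u v w ui vj wl.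
rewrite -[LHS]/(cd (c := K ⊗c (L ⊗c M)) (tassoc K L M _)).
rewrite -[RHS]/(tassoc K L M (cd (c := (K ⊗c L) ⊗c M) _)) tassocE.
have -> : cd (c := (K ⊗c L) ⊗c M) (u *t v *t w) = cd u *t v *t w
    + (-1) ^ i *: (u *t cd v *t w) + (-1) ^ (i + j) *: (u *t v *t cd w).
  rewrite (cd_tpure _ (homog_tpure ui vj)) (cd_tpure _ ui).
  by congr (_ + _); rewrite linearDl linearZl_LR.
rewrite (cd_tpure _ ui) (cd_tpure _ vj) linearDr linearZr_LR.
rewrite scalerDr scalerA -exprzDr ?unitrN1 // addrA.
by rewrite !(linearD (tassoc K L M)) !(linearZ_LR (tassoc K L M)) !tassocE.
Qed.

Lemma tmapBr (k : fieldType) (A B C D : lmodType k) (f : {linear A -> C})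
    (g h : {linear B -> D}) y :
  tmap f (g \- h) y = tmap f g y - tmap f h y.
Proof.
apply: (eq_tens_lin (f := tmap f (g \- h)) (g := tmap f g \- tmap f h)) => a b.
by rewrite -[RHS]/(tmap f g _ - tmap f h _) !tmapE -linearBr.
Qed.

(** * Iterating a twisting map *)

Section Twist.
Variables (k : fieldType) (K : cochain k) (Omega : dga k).
Variable psi : {linear K -> K ⊗c Omega}.

Definition twist (X : lmodType k) : {linear K ⊗ X -> K ⊗ (Omega ⊗ X)} :=
  tassoc K Omega X \o tmap psi idfun.

Lemma twistE (X : lmodType k) a (x : X) :
  twist X (a *t x) = tassoc K Omega X (psi a *t x).
Proof. by rewrite /= tmapE. Qed.

(** [twist] touches only the K-factor, so it is natural in X without any sign,
    including for maps g such as [bar_mul] that do not preserve the number of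
    factors. *)
Lemma twist_tmap (X Y : lmodType k) (g : {linear X -> Y}) y :
  twist Y (tmap idfun g y) = tmap idfun (tmap idfun g) (twist X y).
Proof.
apply: (eq_tens_lin (f := twist Y \o tmap idfun g)
  (g := tmap idfun (tmap idfun g) \o twist X)) => a x.
rewrite -[LHS]/(twist Y (tmap idfun g _)).
rewrite -[RHS]/(tmap idfun (tmap idfun g) (twist X _)) tmapE !twistE.
have [s ->] := tens_gen (psi a).
rewrite !linear_sumlz !linear_sum; apply: eq_bigr => p _.
by rewrite !tassocE !tmapE.
Qed.

(** Two successive twists put the two newest factors of Ω next to each other in
    front, and so multiplying them does not involve x: this reduces the
    quadratic term for any X to the one in the Maurer-Cartan equation. *)
Lemma tmull_twist (X : lmodType k) z (x : X) :
  tmap idfun (tmull Omega X) (twist _ (tassoc K Omega X (z *t x))) =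
  tassoc K Omega X (tmap idfun (tmul Omega) (twist Omega z) *t x).
Proof.
have [s ->] := tens_gen z; rewrite linear_sumlz !linear_sum linear_sumlz linear_sum.
apply: eq_bigr => p _; rewrite tassocE !twistE.
have [t ->] := tens_gen (psi p.1); rewrite !linear_sumlz !linear_sum linear_sumlz linear_sum.
apply: eq_bigr => q _; by rewrite !tassocE !tmapE tmulE tmullE tassocE.
Qed.

Hypothesis psi_twisting : twisting_map psi.

(** The value of the squared twisted differential at a ⊗ 1: the unit turns the
    quadratic operator on K ⊗ Ω into an equation between maps out of K. *)
Lemma twisting_MC a :
  psi (cd a) + cd (psi a) + tmap idfun (tmul Omega) (twist Omega (psi a)) = 0.
Proof.
have unitE b : tmap idfun (tmul Omega) (tassoc K Omega Omega (b *t dunit Omega)) = b.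
  have [s ->] := tens_gen b; rewrite linear_sumlz !linear_sum; apply: eq_bigr => p _.
  by rewrite tassocE tmapE tmulE dmul1r.
have tw1 i b : homog i b -> twisted_cd psi (b *t dunit Omega) = cd b *t dunit Omega + psi b.
  by move=> bi; rewrite (twisted_cdE _ _ bi) cd_dunit linear0r scaler0 addr0 unitE.
pose F := (psi \o cd) \+ (cd \o psi)
  \+ (tmap idfun (tmul Omega) \o twist Omega \o psi).
apply: (@eq_homog _ K _ F \0) => i v vi.
have := psi_twisting.2 (v *t dunit Omega).
rewrite (tw1 _ _ vi) linearD (tw1 _ _ (cd_deg vi)) cd_cd linear0l add0r => vMC.
rewrite -[RHS]vMC; exact: esym (addrA _ _ _).
Qed.

(** The two terms with d on X occur with signs (-1)^|a| and (-1)^(|a|+1),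
    because psi a has degree |a| + 1, and cancel; what remains is the
    Maurer-Cartan equation in the K-factor. *)
Lemma twist_cd (X : cochain k) y :
  twist X (cd (c := K ⊗c X) y) + cd (c := K ⊗c (Omega ⊗c X)) (twist X y) =
  - tmap idfun (tmull Omega X) (twist _ (twist X y)).
Proof.
pose F := (twist X \o cd (c := K ⊗c X)) \+ (cd (c := K ⊗c (Omega ⊗c X)) \o twist X).
pose G := \- (tmap idfun (tmull Omega X) \o twist _ \o twist X).
apply: (@eq_tens_homog _ K X _ F G) => i j a x ai xj.
rewrite -[LHS]/(twist X (cd (c := K ⊗c X) _) + cd (c := K ⊗c (Omega ⊗c X)) (twist X _)).
rewrite -[RHS]/(- tmap idfun (tmull Omega X) (twist _ (twist X _))).
rewrite (cd_tpure _ ai) (linearD (twist X)) (linearZ_LR (twist X)) !twistE.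
rewrite tmull_twist cd_tassoc (cd_tpure _ (psi_twisting.1 _ _ ai)).
rewrite (linearD (tassoc K Omega X)) (linearZ_LR (tassoc K Omega X)).
rewrite exprzDr ?unitrN1 // expr1z mulrN1 scaleNr addrACA subrr addr0.
rewrite -(linearD (tassoc K Omega X)) -linearDl -linearN -linearNl.
congr (tassoc _ _ _ (_ *t _)); apply/eqP.
by rewrite -addr_eq0 twisting_MC.
Qed.

Lemma of_degree_twist (X : cochain k) :
  of_degree (K := K ⊗c X) (L := K ⊗c (Omega ⊗c X)) 1 (twist X).
Proof.
apply: (@of_degree_tens _ K X (K ⊗c (Omega ⊗c X))) => i j a x ai xj.
rewrite twistE -[_ + 1]addr0; apply: of_degree_tassoc.
rewrite addrAC; apply: homog_tpure xj; exact: psi_twisting.1.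
Qed.

Lemma psi_iterS n a : psi_iter psi n.+1 a = twist (tpow Omega n) (psi_iter psi n a).
Proof. by []. Qed.

Lemma psi_iter_deg n :
  of_degree (L := K ⊗c tpow Omega n) n.+1%:Z (psi_iter psi n).
Proof.
elim: n => [|n IH] i v vi; first exact: psi_twisting.1.
rewrite psi_iterS -[n.+2]addn1 PoszD addrA.
by apply: of_degree_twist; apply: IH.
Qed.

(** Commuting T past d in the inductive step creates the term - (1 ⊗ μ) T T,
    while the term in b_n passes through T unchanged; together they
    make up - (1 ⊗ b_(n+1)), which explains both the alternating signs of the
    bar multiplication and the global sign (-1)^(n+1). *)
Lemma psi_iter_cd n a :
  psi_iter psi n (cd a) = (-1) ^+ n.+1 *:
    (cd (c := K ⊗c tpow Omega n) (psi_iter psi n a)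
     + tmap idfun (bar_mul Omega n) (psi_iter psi n.+1 a)).
Proof.
elim: n a => [|n IH] a.
  rewrite psi_iterS /= scaleN1r; apply/eqP; rewrite -addr_eq0 addrA; apply/eqP.
  exact: twisting_MC.
have bar_mulS y : tmap idfun (bar_mul Omega n.+1) y =
    tmap idfun (tmull Omega (tpow Omega n)) y
    - tmap (idfun : {linear K -> K}) (tmap idfun (bar_mul Omega n)) y.
  exact: tmapBr.
rewrite psi_iterS IH (linearZ_LR (twist _)) (linearD (twist _)).
rewrite twist_tmap -!psi_iterS bar_mulS.
have regroup (V : lmodType k) (A B C : V) :
    (-1) ^+ n.+1 *: (- A - B + C) = (-1) ^+ n.+2 *: (B + (A - C)).
  rewrite [(-1) ^+ n.+2]exprS mulN1r scaleNr -scalerN; congr (_ *: _).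
  by rewrite !opprD opprK addrA [- A - B]addrC.
have /(canRL (addrK _)) -> := twist_cd (psi_iter psi n a).
exact: regroup.
Qed.

End Twist.

(** * Contraction with the augmentation *)

Section Augmentation.
Variables (k : fieldType) (K : cochain k) (eps : {linear K -> unit_cochain k}).
Hypothesis eps_aug : cochain_map eps.

Lemma aug_homog0 i a : homog i a -> i != 0 -> eps a = 0.
Proof.
move=> ai i0; have := eps_aug.1 _ _ ai.
by rewrite addr0 /homog /= /unit_gpr (negPf i0) => <-.
Qed.

Lemma eps_contractE (X : lmodType k) a (x : X) :
  eps_contract eps X (a *t x) = (eps a : k) *: x.
Proof. exact: tens_liftB. Qed.

Lemma eps_contract_tmap (X Y : lmodType k) (g : {linear X -> Y}) y :
  eps_contract eps Y (tmap idfun g y) = g (eps_contract eps X y).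
Proof.
have [s ->] := tens_gen y; rewrite !linear_sum; apply: eq_bigr => p _.
by rewrite tmapE !eps_contractE linearZ_LR.
Qed.

(** The Koszul sign (-1)^|a| in d(a ⊗ x) disappears because the augmentation
    kills a unless |a| = 0. *)
Lemma cd_eps_contract (X : cochain k) y :
  eps_contract eps X (cd (c := K ⊗c X) y) = cd (eps_contract eps X y).
Proof.
apply: (@eq_tens_homog _ K X _ (eps_contract eps X \o cd (c := K ⊗c X))
  (cd \o eps_contract eps X)) => i j a x ai xj.
rewrite -[LHS]/(eps_contract eps X (cd (c := K ⊗c X) _)).
rewrite -[RHS]/(cd (eps_contract eps X _)) (cd_tpure _ ai).
rewrite (linearD (eps_contract eps X)) (linearZ_LR (eps_contract eps X)).
rewrite !eps_contractE eps_aug.2 scale0r add0r (linearZ_LR cd).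
have [->|i0] := eqVneq i 0; first by rewrite scale1r.
by rewrite (aug_homog0 ai i0) !scale0r scaler0.
Qed.

Lemma of_degree_eps_contract (X : cochain k) :
  of_degree (K := K ⊗c X) 0 (eps_contract eps X).
Proof.
apply: of_degree_tens => i j a x ai xj; rewrite addr0 eps_contractE.
have [->|i0] := eqVneq i 0; first by rewrite add0r /homog linearZ_LR xj.
by rewrite (aug_homog0 ai i0) scale0r /homog linear0.
Qed.

End Augmentation.

(** * The map to the bar complex *)

Theorem lemma4 (k : fieldType) (k_char0 : [pchar k] =i pred0)
    (K : cochain k) (eps : {linear K -> unit_cochain k})
    (eps_aug : cochain_map eps)
    (Omega : dga k) (psi : {linear K -> K ⊗c Omega})
    (psi_twisting : twisting_map psi)
    (psi_nilp : forall a : K, exists n : nat,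
       forall j : nat, (n <= j.+1)%N -> psi_part eps psi j a = 0) :
  exists psit : {linear K -> bar_cochain Omega},
    (forall a : K, exists N : nat, forall M : nat, (N <= M)%N ->
       psit a = \sum_(j < M) dinj (fun n => tpow Omega n) j (psi_part eps psi j a))
    /\ cochain_map psit.
Proof.
have fin a : exists N, forall n, (N <= n)%N -> psi_part eps psi n a = 0.
  (* The part of index n has n+1 factors, hence the shift. *)
  by have [N aN] := psi_nilp a; exists N => n Nn; apply/aN/leqW.
pose f a : bar Omega := DSum (fin a).
have f_linear : linear f by move=> c a b; apply: dsum_ext => n; apply: linearP.
have partE n a : psi_part eps psi n a = eps_contract eps _ (psi_iter psi n a) by [].
exists (mk_linear f_linear : {linear K -> bar_cochain Omega}); split=> [a|].
  have [N aN] := fin a; exists N => M NM; rewrite mk_linearE.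
  by apply: (dsum_eq (f := f a)) => n Mn; apply/aN/leq_trans/Mn.
split=> [i a ai|a]; rewrite !mk_linearE; apply: dsum_ext => n.
  rewrite /homog addr0 bar_gprE; rewrite -[dsum_val _ _]/(psi_part eps psi n a).
  rewrite partE -[X in gpr _ X]addr0; apply: of_degree_eps_contract => //.
  exact: psi_iter_deg.
rewrite bar_cdE -![dsum_val _ _]/(psi_part eps psi _ _) !partE.
rewrite psi_iter_cd // (linearZ_LR (eps_contract eps _)).
rewrite (linearD (eps_contract eps _)) cd_eps_contract // eps_contract_tmap.
by rewrite scalerDr [(-1) ^+ n.+2]exprS mulN1r scaleNr opprK.
Qed.
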